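(* Let $p$ be a prime and $n\ge\frac12(p-1)(p^2-p+4)$. If $L(X)=\sum_{i=0}^{n-1}a_iX^{p^i}\in\mathbb{F}_{p^n}[X]$ satisfies $\mathrm{Tr}_{p^n/p}(L(x)/x)\neq0$ for all $x\in\mathbb{F}_{p^n}^*$, then $a_1=\cdots=a_{n-1}=0$.
   Context: $\mathrm{Tr}_{p^n/p}$ denotes the trace map from $\mathbb{F}_{p^n}$ to $\mathbb{F}_p$. *)

(* Defs.v *)
From HB Require Import structures.
From mathcomp Require Import all_boot all_order all_algebra all_fingroup.
From mathcomp Require Import all_solvable all_field.
Set Implicit Arguments.
Unset Strict Implicit.
Unset Printing Implicit Defensive.

Import GRing.Theory.
Local Open Scope ring_scope.

(* The trace from F = F_(p^n) to its prime field, as an element of F; 1 is the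
   prime subfield of F, seen as an extension of 'F_p by pPrimeCharType. *)
Definition absTrace (p n : nat) (F : finFieldType) (p_pr : prime p)
    (cardF : #|F| = (p ^ n)%N) (x : F) : F :=
  galTrace 1 {:pPrimeCharType (card_finPcharP cardF p_pr)} x.

Lemma absTraceE (p n : nat) (F : finFieldType) (p_pr : prime p)
    (cardF : #|F| = (p ^ n)%N) (x : F) :
  absTrace p_pr cardF x = \sum_(i < n) x ^+ (p ^ i).
Proof.
rewrite /absTrace; set pcF := card_finPcharP _ _; pose L := pPrimeCharType pcF.
have s1L : (1 <= {:L})%VS by apply: sub1v.
have [/= alpha gen_alpha Dalpha] := finField_galois_generator s1L.
rewrite card_Fp //= dimv1 expn1 in Dalpha.
have galX i (y : L) : (alpha ^+ i)%g y = y ^+ (p ^ i).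
  elim: i y => [|i IHi] y; first by rewrite expg0 gal_id expn0 expr1.
  by rewrite expgSr galM ?memvf // IHi Dalpha ?memvf // expnSr exprM.
have defG : ('Gal({:L} / 1) = <[alpha]>)%g by apply/eqP.
have ord_alpha : #[alpha]%g = n.
  have /galois_dim := finField_galois s1L.
  rewrite dimv1 divn1 defG -orderE => <-.
  have := card_vspace (fullv : {vspace L}); rewrite card_Fp // card_vspacef.
  have -> : #|L| = #|F| by [].
  by rewrite cardF => /eqP; rewrite eqn_exp2l ?prime_gt1 // => /eqP.
rewrite /galTrace defG -ord_alpha -(big_mkord xpredT (fun i => x ^+ (p ^ i))).
rewrite -[RHS]/(\sum_(0 <= i < #[alpha]%g) (x : L) ^+ (p ^ i)) big_mkord.
have inj_exp : injective (fun i : 'I_#[alpha]%g => (alpha ^+ i)%g).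
  move=> i j /eqP; rewrite eq_expg_mod_order !modn_small // => /eqP eq_ij.
  exact: val_inj.
have -> : <[alpha]>%g = [set (alpha ^+ i)%g | i : 'I_#[alpha]%g].
  apply/setP=> y; apply/idP/imsetP => [/cyclePmin[i lt_i ->] | [i _ ->]].
    by exists (Ordinal lt_i).
  exact: mem_cycle.
rewrite big_imset /= => [|i j _ _ /inj_exp->] //.
by apply: eq_bigr => i _; apply: galX.
Qed.

(* Main.v *)
Require Import Defs.
From HB Require Import structures.
From mathcomp Require Import all_boot all_order all_algebra all_fingroup.
From mathcomp Require Import all_solvable all_field.
From mathcomp Require Import zify ring.
Import GRing.Theory.
Set Implicit Arguments.
Unset Strict Implicit.
Unset Printing Implicit Defensive.

(* For x != 0 the trace of L(x)/x is
     f(x) = \sum_(j, k) b j k x^(p^k) / x^(p^j),   b j k = a_(k - j)^(p^j),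
   with indices modulo n, and f^(p-1) = 1 on the nonzero elements, so every
   coefficient of f^(p-1) at an exponent not divisible by p^n - 1 vanishes.
   Suppose a_i != 0 with i != 0; replacing x by 1/x we may take 2i <= n. Choose
   p - 1 distinct rows J m such that no J m + i or J m + i + 1 is a row again.
   An exponent \sum_m p^(k_m) - \sum_m p^(J m) with columns k_m among the
   J m + i then has essentially one such representation modulo p^n - 1, because
   adding p - 1 further powers of p produces at most one carry in base p. Hence
   its coefficient in f^(p-1) is (p-1)! times a coefficient of the product of
   the p - 1 nonzero linear forms \sum_k b (J m) k X_k; the leading one is not
   zero, a contradiction. *)

(** * Base-p digit vectors and carries modulo p^n - 1 *)

Lemma leq_sum_eq (I : finType) (f g : I -> nat) :
  (forall i, f i <= g i) -> \sum_i f i = \sum_i g i -> f =1 g.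
Proof.
move=> le_fg + i; rewrite (bigD1 i) //= [RHS](bigD1 i) //=.
have : \sum_(j | j != i) f j <= \sum_(j | j != i) g j by apply: leq_sum => j _.
by have := le_fg i; lia.
Qed.

Lemma digit_val_lt (p n : nat) (S : 'I_n -> nat) :
  (forall k, S k < p) -> \sum_(k < n) S k * p ^ k < p ^ n.
Proof.
elim: n S => [|n IHn] S Sp; first by rewrite big_ord0.
rewrite big_ord_recr /= expnS.
apply: (@leq_trans ((S ord_max).+1 * p ^ n)); last by rewrite leq_mul2r Sp orbT.
rewrite mulSn ltn_add2r.
exact: IHn (fun k => S (widen_ord (leqnSn n) k)) (fun k => Sp _).
Qed.

Lemma digit_val_inj (p n : nat) (S T : 'I_n -> nat) :
  (forall k, S k < p) -> (forall k, T k < p) ->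
  \sum_(k < n) S k * p ^ k = \sum_(k < n) T k * p ^ k -> S =1 T.
Proof.
elim: n S T => [|n IHn] S T Sp Tp; first by move=> _ [].
rewrite !big_ord_recr /=; set w := widen_ord _.
have := digit_val_lt (fun k => Sp (w k)).
have := digit_val_lt (fun k => Tp (w k)).
move=> Tlt Slt E.
have eq_max : S ord_max = T ord_max.
  have := congr1 (fun m => m %/ p ^ n) E.
  by rewrite /= !divnDMl ?(leq_ltn_trans _ Slt) // !divn_small.
have /(IHn (S \o w) (T \o w) (fun k => Sp _) (fun k => Tp _)) eqw :
  \sum_(k < n) S (w k) * p ^ k = \sum_(k < n) T (w k) * p ^ k.
  by move: E; rewrite eq_max => /addIn.
move=> k; case: (unliftP ord_max k) => [j|] -> //.
by have -> : lift ord_max j = w j; [apply/val_inj/lift_max | apply: eqw].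
Qed.

Lemma digit_val_max (p n : nat) : 0 < p ->
  \sum_(k < n) p.-1 * p ^ k = (p ^ n).-1.
Proof. by move=> p0; rewrite -big_distrr /= predn_exp. Qed.

(** A digit sum below n(p - 1) excludes the vector with all digits p - 1, the only one whose value
    reaches p^n - 1. Below that value, congruence is equality. *)
Lemma digit_val_mod_inj (p n : nat) (S T : 'I_n -> nat) : 1 < p ->
  (forall k, S k < p) -> (forall k, T k < p) ->
  0 < \sum_k S k < n * p.-1 -> 0 < \sum_k T k < n * p.-1 ->
  \sum_(k < n) S k * p ^ k = \sum_(k < n) T k * p ^ k %[mod (p ^ n).-1] ->
  S =1 T.
Proof.
move=> p1 Sp Tp Sb Tb E; apply: (digit_val_inj Sp Tp).
have small (R : 'I_n -> nat) : (forall k, R k < p) ->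
  0 < \sum_k R k < n * p.-1 -> \sum_(k < n) R k * p ^ k < (p ^ n).-1.
  move=> Rp /andP[_ Rlt]; have Rval := digit_val_lt Rp.
  rewrite ltn_neqAle -ltnS prednK ?expn_gt0 ?(ltnW p1) // Rval andbT.
  apply/negP => /eqP; rewrite -digit_val_max ?(ltnW p1) // => /digit_val_inj Req.
  move: Rlt; rewrite (eq_bigr (fun=> p.-1)) ?sum_nat_const ?card_ord ?ltnn //.
  by move=> k _; apply: Req => // _; rewrite prednK // ltnW.
by move: E; rewrite !modn_small ?small.
Qed.

Lemma expn_ordS (p n : nat) (k : 'I_n) : 0 < p ->
  p * p ^ k = p ^ ordS k %[mod (p ^ n).-1].
Proof.
move=> p0; case: n k => [[]//|n] k; rewrite -expnS /=.
case: (ltngtP k n) => [lt_kn|gt_kn|->]; first by rewrite (@modn_small k.+1).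
  by have := ltn_ord k; lia.
rewrite modnn expn0; have := @prednK (p ^ n.+1); rewrite expn_gt0 p0 => /(_ isT).
by move: (_.-1) => M <-; rewrite -add1n modnDr.
Qed.

Lemma ordS_neq (n : nat) (k : 'I_n) : 1 < n -> ordS k != k.
Proof.
move=> n1; apply/eqP => /(congr1 val) /=; have := ltn_ord k.
rewrite leq_eqVlt => /orP[/eqP e|lt]; first by rewrite e modnn; lia.
by rewrite modn_small //; lia.
Qed.

(* A vector of digit sum 2(p-1) has at most one digit >= p, and carrying it
   over (cyclically, since the modulus is p^n - 1) cannot create a new one. *)
Lemma carry_normalize (p n : nat) (S : 'I_n -> nat) : 1 < p -> 1 < n ->
  \sum_k S k = 2 * p.-1 ->
  exists (o : option 'I_n) (R : 'I_n -> nat),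
  [/\ forall k, R k < p,
      forall k, R k + p * (o == Some k) = S k + (omap (@ordS n) o == Some k),
      \sum_k R k + p.-1 * isSome o = 2 * p.-1
    & \sum_(k < n) R k * p ^ k = \sum_(k < n) S k * p ^ k %[mod (p ^ n).-1]].
Proof.
move=> p1 n1 sumS.
(* Hence if some digit is at least p, every other digit is at most p - 2 and can absorb the
   carry. *)
have pairS k l : k != l -> S k + S l <= 2 * p.-1.
  move=> neq; rewrite -sumS (bigD1 k) //= (bigD1 l) 1?eq_sym //=; lia.
case: (pickP (fun k => p <= S k)) => [k Sk|Slt]; last first.
  exists None, S; split=> //= [k|k|]; rewrite ?muln0 ?addn0 //.
  by rewrite ltnNge Slt.
have neqk : ordS k != k by apply: ordS_neq.
pose R m := S m + (ordS k == m) - p * (k == m).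
have RE m : R m + p * (k == m) = S m + (ordS k == m).
  by rewrite /R; case: (eqVneq k m) => [<-|]; lia.
have sumE (G : 'I_n -> nat) m : \sum_l (m == l) * G l = G m.
  rewrite (bigD1 m) //= eqxx mul1n big1 ?addn0 // => l.
  by rewrite eq_sym => /negbTE ->.
exists (Some k), R; split=> //=.
- move=> m; have := RE m; case: (eqVneq k m) => [<-|neq].
    rewrite (negbTE neqk); have : S k <= 2 * p.-1 by rewrite -sumS (bigD1 k) //= leq_addr.
    lia.
  by have := pairS _ _ neq; lia.
- have : \sum_m (R m + p * (k == m)) = \sum_m (S m + (ordS k == m)).
    by apply: eq_bigr => m _.
  rewrite !big_split /= sumS -big_distrr /=.
  have e m : \sum_(l < n) (m == l) = 1.
    by rewrite -[RHS](sumE (fun=> 1) m); apply: eq_bigr => l _; rewrite muln1.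
  by rewrite !e; lia.
have : \sum_m (R m + p * (k == m)) * p ^ m = \sum_m (S m + (ordS k == m)) * p ^ m.
  by apply: eq_bigr => m _; rewrite RE.
under eq_bigr do rewrite mulnDl -mulnA.
under [RHS]eq_bigr do rewrite mulnDl.
rewrite !big_split /= -big_distrr /= !sumE => E.
apply/eqP; rewrite -(eqn_modDr (p * p ^ k)) E; apply/eqP.
by rewrite -modnDmr -expn_ordS ?modnDmr // ltnW.
Qed.

(** Both sides have digit sum 2(p - 1) and normalize to the same vector. Once the carries are known
    to agree, u + v' = u' + v pointwise; as v vanishes wherever u does not, u <= u', and equal
    totals force equality. *)
Lemma signed_rep_unique (p n : nat) (u v u' v' : 'I_n -> nat) :
  1 < p -> 2 < n ->
  \sum_k u k = p.-1 -> \sum_k v k = p.-1 ->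
  \sum_k u' k = p.-1 -> \sum_k v' k = p.-1 ->
  (forall k, v k <= 1) ->
  (forall k, 0 < u k -> v k = 0 /\ v (ordS k) = 0) ->
  \sum_(k < n) u k * p ^ k + \sum_(k < n) v' k * p ^ k =
    \sum_(k < n) u' k * p ^ k + \sum_(k < n) v k * p ^ k %[mod (p ^ n).-1] ->
  u =1 u' /\ v =1 v'.
Proof.
move=> p1 n2 su sv su' sv' v1 uv.
have lt2n : 2 * p.-1 < n * p.-1 by rewrite ltn_mul2r n2 andbT -ltnS prednK // ltnW.
have bound (m : nat) (c : bool) : m + p.-1 * c = 2 * p.-1 -> 0 < m < n * p.-1.
  move: (n * _) lt2n => M; clear -p1.
  by case: c; rewrite ?muln1 ?muln0; lia.
move=> E.
have point (w : 'I_n -> nat) k l : \sum_k w k = p.-1 -> k != l -> w k + w l <= p.-1.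
  by move=> <- neq; rewrite (bigD1 k) //= (bigD1 l) 1?eq_sym //=; lia.
have point1 (w : 'I_n -> nat) k : \sum_k w k = p.-1 -> w k <= p.-1.
  by move=> <-; rewrite (bigD1 k) //= leq_addr.
have [|o [R [Rp RE sR vR]]] := @carry_normalize p n (fun k => u k + v' k) p1 (ltnW n2).
  by rewrite big_split /= su sv'; lia.
have [|q [Q [Qp QE sQ vQ]]] := @carry_normalize p n (fun k => u' k + v k) p1 (ltnW n2).
  by rewrite big_split /= su' sv; lia.
have RQ : R =1 Q.
  apply: (digit_val_mod_inj p1 Rp Qp (bound _ _ sR) (bound _ _ sQ)).
  rewrite vR vQ; under eq_bigr do rewrite mulnDl.
  under [in RHS]eq_bigr do rewrite mulnDl.
  by rewrite !big_split.
clear E vR vQ; suff eqoq : o = q.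
  have ST k : u k + v' k = u' k + v k.
    by have := RE k; have := QE k; rewrite eqoq RQ; lia.
  have le_uu' k : u k <= u' k.
    by case: (posnP (u k)) => [-> //|/uv[vk _]]; have := ST k; lia.
  have eq_uu' : u =1 u' by apply: leq_sum_eq => //; rewrite su su'.
  by split=> // k; have := ST k; rewrite eq_uu'; lia.
have sRQ : \sum_k R k = \sum_k Q k by apply: eq_bigr => k _.
(* Each carry lowers the digit sum by p - 1, so either both sides carry or neither does. *)
case: o q RE QE sR sQ => [k|] [l|] //= RE QE; rewrite sRQ ?muln0 ?muln1;
  [move=> _ _ | move=> e1 e2 | move=> e1 e2]; first last.
- by have /addnI := etrans e2 (esym e1); lia.
- by have /addnI := etrans e1 (esym e2); lia.
 (* Suppose the left side carries at k and the right side at l != k. The first carry forces u k > 0,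
    so v vanishes at k and [ordS k]; the second forces u' l = p - 1, the whole total of u'. But the
    unit carried into [ordS k] needs u' ([ordS k]) > 0. *)
 case: (eqVneq k l) => [-> //|neq]; exfalso.
have eqp m : u m + v' m + (ordS k == m) + p * (l == m)
           = u' m + v m + (ordS l == m) + p * (k == m).
  have := RE m; have := QE m; rewrite /= RQ.
  by rewrite !(inj_eq Some_inj); case: (k == m); case: (l == m); lia.
have neqS (m : 'I_n) : (ordS m == m) = false by apply/negbTE/ordS_neq/ltnW.
have uk : 0 < u k.
  by have := eqp k; have := point1 _ k sv'; rewrite neqS eqxx eq_sym (negbTE neq); lia.
have [vk vSk] := uv _ uk.
have := eqp l; rewrite neqS eqxx (negbTE neq) => el.
have u'l := point1 _ l su'; have vl := v1 l.
have neSkl : ordS k != l by apply/eqP=> e; rewrite e eqxx in el; lia.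
have := eqp (ordS k); rewrite eqxx vSk (inj_eq (@ordS_inj n)) (eq_sym l k) (negbTE neq).
rewrite (eq_sym k) neqS; have := point _ _ _ su' neSkl; lia.
Qed.

(** * Multiplicities of the values of an index map *)

Definition occ (M n : nat) (t : 'I_M -> 'I_n) (k : 'I_n) : nat :=
  \sum_(m < M) (t m == k).

(** For G k = p^k this makes [occ t] the digit vector of a sum of powers of p, with digits not yet
    reduced. *)
Lemma sum_occ (M n : nat) (t : 'I_M -> 'I_n) (G : 'I_n -> nat) :
  \sum_(k < n) occ t k * G k = \sum_(m < M) G (t m).
Proof.
under eq_bigr do rewrite big_distrl /=.
rewrite exchange_big; apply: eq_bigr => m _ /=.
rewrite (bigD1 (t m)) //= eqxx mul1n big1 ?addn0 // => k.
by rewrite eq_sym => /negbTE ->.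
Qed.

Lemma occ_total (M n : nat) (t : 'I_M -> 'I_n) : \sum_(k < n) occ t k = M.
Proof.
have := sum_occ t (fun=> 1); rewrite sum1_card card_ord => e.
by rewrite -[RHS]e; apply: eq_bigr => k _; rewrite muln1.
Qed.

Lemma occ_gt0P (M n : nat) (t : 'I_M -> 'I_n) (k : 'I_n) :
  reflect (exists m, t m = k) (0 < occ t k).
Proof.
apply: (iffP idP) => [|[m <-]]; last by rewrite /occ (bigD1 m) //= eqxx.
rewrite lt0n sum_nat_eq0 => /forallPn[m]; case: (t m =P k) => [e _|//].
by exists m.
Qed.

Lemma occ_inj_le1 (M n : nat) (t : 'I_M -> 'I_n) :
  injective t <-> (forall k, occ t k <= 1).
Proof.
split=> [inj_t k | occ1 m1 m2 e].
  case: (posnP (occ t k)) => [-> //|/occ_gt0P[m <-]].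
  rewrite /occ (bigD1 m) //= eqxx big1 // => m' /negbTE neq.
  by rewrite (inj_eq inj_t) neq.
apply/eqP; apply/idPn => neq; have := occ1 (t m1).
by rewrite /occ (bigD1 m1) //= (bigD1 m2) 1?eq_sym //= e eqxx; lia.
Qed.

Local Open Scope ring_scope.

(** * Power sums over the nonzero elements of a finite field *)

Lemma finField_prim_root (F : finFieldType) :
  exists g : F, #|F|.-1.-primitive_root g.
Proof.
have F1 : (0 < #|F|.-1)%N by rewrite -subn1 subn_gt0 finNzRing_gt1.
have /hasP[g _ gP] : has (#|F|.-1).-primitive_root (enum (predC1 (0 : F))).
  apply: has_prim_root => //.
  - apply/allP => x; rewrite mem_enum => x0.
    apply/unity_rootP/(mulfI x0); rewrite -exprS prednK ?expf_card ?mulr1 //.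
    by apply/card_gt0P; exists 0.
  - exact: enum_uniq.
  by rewrite -cardE cardC1.
by exists g.
Qed.

(** Orthogonality of characters: replacing x by g x, with g a generator, multiplies the sum by g^a /
    g^b, which differs from 1 unless the exponents are congruent. *)
Lemma sum_expf_ratio (F : finFieldType) (a b : nat) :
  \sum_(x : F | x != 0) x ^+ a / x ^+ b
    = if a == b %[mod #|F|.-1] then #|F|.-1%:R else 0.
Proof.
have [g gP] := finField_prim_root F.
have q0 : (0 < #|F|.-1)%N by apply: prim_order_gt0 gP.
have qF : (#|F|.-1.+1 = #|F|)%N by rewrite prednK // (leq_trans q0) ?leq_pred.
have g0 : g != 0 by rewrite (prim_root_eq0 gP) -lt0n.
rewrite -(eq_prim_root_expr gP); case: eqP => [eq_ab|neq_ab].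
  rewrite (eq_bigr (fun=> 1)) => [|x x0].
    by rewrite sumr_const -(cardC1 (0 : F)).
  have [|i ->] := prim_rootP gP (x := x).
    by apply: (mulfI x0); rewrite -exprS qF expf_card mulr1.
  by rewrite -!exprM !(mulnC i) !exprM eq_ab divff // !expf_neq0.
set S := \sum_(x | _) _.
have : S * (g ^+ a / g ^+ b) = S.
  rewrite [RHS](reindex_inj (mulfI g0)) /= mulr_suml.
  apply: eq_big => [x|x x0]; first by rewrite mulf_eq0 negb_or g0.
  by rewrite !exprMn invfM; ring.
move/eqP; rewrite -subr_eq0 -{2}[S]mulr1 -mulrBr mulf_eq0 subr_eq0 => /orP[/eqP //|].
rewrite -[1](@divff _ (g ^+ b)) ?expf_neq0 // => /eqP/(mulIf _) e.
by case: neq_ab; apply: e; rewrite invr_eq0 expf_neq0.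
Qed.

Lemma prime_ndvd_fact (p m : nat) : prime p -> (m < p)%N -> ~~ (p %| m`!)%N.
Proof.
move=> p_pr; elim: m => [|m IHm] lt_mp; first by rewrite dvdn1 neq_ltn prime_gt1 ?orbT.
by rewrite factS Euclid_dvdM // negb_or IHm 1?ltnW // andbT gtnNdvd.
Qed.

(** * Coefficients of powers of the form f *)

Definition ratio_form (p n : nat) (F : fieldType) (b : 'I_n -> 'I_n -> F)
    (x : F) : F :=
  \sum_(j < n) \sum_(k < n) b j k * (x ^+ (p ^ k) / x ^+ (p ^ j)).

Lemma ratio_form_expr (p n : nat) (F : fieldType) (b : 'I_n -> 'I_n -> F)
    (M : nat) (x : F) :
  ratio_form p b x ^+ M =
  \sum_(t : {ffun 'I_M -> 'I_n * 'I_n}) (\prod_m b (t m).1 (t m).2) *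
    (x ^+ (\sum_m p ^ (t m).2)%N / x ^+ (\sum_m p ^ (t m).1)%N).
Proof.
rewrite /ratio_form pair_bigA /= -[in LHS](card_ord M) -prodr_const /=.
rewrite bigA_distr_bigA /=; apply: eq_bigr => t _.
by rewrite big_split /= prodf_div !expr_sum.
Qed.

(** Multiply f^M = 1 by x^V / x^U and sum over x != 0: orthogonality keeps the terms of exponent U -
    V, and the common factor #|F| - 1 is invertible in F. *)
Lemma ratio_form_coef (p n : nat) (F : finFieldType) (b : 'I_n -> 'I_n -> F)
    (M U V : nat) :
  (forall x, x != 0 -> ratio_form p b x ^+ M = 1) ->
  \sum_(t : {ffun 'I_M -> 'I_n * 'I_n} |
          (U + \sum_m p ^ (t m).1 == \sum_m p ^ (t m).2 + V %[mod #|F|.-1])%N)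
      \prod_m b (t m).1 (t m).2
  = (U == V %[mod #|F|.-1])%N%:R.
Proof.
move=> f1; have [g gP] := finField_prim_root F.
have c0 := prim_root_natf_neq0 gP; apply: (mulIf c0).
transitivity (\sum_(x : F | x != 0) ratio_form p b x ^+ M * (x ^+ V / x ^+ U)); last first.
  under eq_bigr => x x0 do rewrite f1 // mul1r.
  by rewrite sum_expf_ratio eq_sym; case: eqP; rewrite ?mul1r ?mul0r.
under [RHS]eq_bigr do rewrite ratio_form_expr mulr_suml.
rewrite exchange_big /= mulr_suml big_mkcond /=; apply: eq_bigr => t _.
transitivity ((\prod_m b (t m).1 (t m).2) * \sum_(x : F | x != 0)
   x ^+ (\sum_m p ^ (t m).2 + V)%N / x ^+ (U + \sum_m p ^ (t m).1)%N).
  by rewrite sum_expf_ratio eq_sym; case: eqP; rewrite ?mulr0.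
rewrite mulr_sumr; apply: eq_bigr => x _.
by rewrite !exprD invfM; ring.
Qed.

Lemma ratio_form_expr_neq1 (p n : nat) (F : finFieldType)
    (b : 'I_n -> 'I_n -> F) (J K : 'I_p.-1 -> 'I_n) :
  prime p -> (2 < n)%N -> #|F| = (p ^ n)%N ->
  injective J -> (forall m, b (J m) (K m) != 0) ->
  (forall m m', K m != J m' /\ ordS (K m) != J m') ->
  ~ (forall x, x != 0 -> ratio_form p b x ^+ p.-1 = 1).
Proof.
move=> p_pr n2 cardF injJ bJK KJ f1; have p1 := prime_gt1 p_pr.
pose B k := [exists m, K m == k].
(* The columns [lead m] give the leading monomial of the product over m of the
   linear forms \sum_(k in B) b (J m) k X_k, whose coefficient cannot cancel. *)
pose supp m k := B k && (b (J m) k != 0).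
pose lead m := [arg max_(k > K m | supp m k) (k : nat)]%N.
have leadP m : [/\ B (lead m), b (J m) (lead m) != 0
    & forall k, B k -> b (J m) k != 0 -> (k <= lead m)%N].
  rewrite /lead; case: arg_maxnP => [|k /andP[Bk bk] max_k].
    by rewrite /supp bJK andbT; apply/existsP; exists m.
  by split=> // l Bl bl; apply: max_k; rewrite /supp Bl.
have leadJ m m' : lead m != J m' /\ ordS (lead m) != J m'.
  by have [/existsP[l /eqP <-] _ _] := leadP m; apply: KJ.
have uniq_rep (u' v' : 'I_p.-1 -> 'I_n) :
    (\sum_m p ^ lead m + \sum_m p ^ v' m
      = \sum_m p ^ u' m + \sum_m p ^ J m %[mod #|F|.-1])%N ->
    occ lead =1 occ u' /\ occ J =1 occ v'.
  rewrite cardF => E.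
  apply: (@signed_rep_unique p n _ _ _ _ p1 n2); rewrite ?occ_total //.
  - exact/occ_inj_le1.
  - move=> k /occ_gt0P[m <-]; have neq0 l : (forall m', l != J m') -> occ J l = 0%N.
      move=> neq; apply/eqP; rewrite -leqn0 leqNgt; apply/negP => /occ_gt0P[m' e].
      by have := neq m'; rewrite e eqxx.
    by split; apply: neq0 => m'; have [] := leadJ m m'.
  by rewrite !(sum_occ _ (fun k : 'I_n => (p ^ k)%N)).
have M0 : (0 < p.-1)%N by rewrite -ltnS prednK // ltnW.
have := ratio_form_coef (\sum_m p ^ lead m) (\sum_m p ^ J m) f1.
(* If U and V were congruent, adding the same constant tuple to both sides would give, by
   uniqueness, [lead] and [J] the same multiplicities, although their values are disjoint. *)
case: eqP => [UV|_].
  have [|e1 e2] := uniq_rep (fun=> J (Ordinal M0)) (fun=> J (Ordinal M0)).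
    by rewrite [in RHS]addnC -modnDml UV modnDml.
  have : (0 < occ lead (lead (Ordinal M0)))%N by apply/occ_gt0P; exists (Ordinal M0).
  rewrite e1 -e2 => /occ_gt0P[m' e].
  by have [] := leadJ (Ordinal M0) m'; rewrite e eqxx.
pose beta := \prod_m b (J m) (lead m).
pose phi (s : 'S_p.-1) := [ffun m => (J (s m), lead (s m))].
have inj_phi : injective phi.
  move=> s1 s2 /ffunP e; apply/permP => m.
  by have := e m; rewrite !ffunE => -[/injJ].
have prod_phi s : \prod_m b (phi s m).1 (phi s m).2 = beta.
  rewrite [RHS](reindex_inj (@perm_inj _ s)) /=.
  by apply: eq_bigr => m _; rewrite ffunE.
have sum_perm (f : 'I_p.-1 -> nat) (s : 'S_p.-1) :
    (\sum_m f (s m) = \sum_m f m)%N.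
  by rewrite [RHS](reindex_inj (@perm_inj _ s)).
(* A nonzero term lies in the image of [phi]: its rows are J permuted by some s, and its columns are
   at most [lead (s m)] by maximality. The column indices have the same sum as the leading ones, so
   equality holds throughout. *)
rewrite (bigID (fun t => t \in phi @: 'S_p.-1)) /= [X in _ + X]big1 ?addr0; last first.
  move=> t /andP[/eqP /(uniq_rep (fun m => (t m).2) (fun m => (t m).1)) [e2 e1]].
  apply: contraNeq; rewrite prodf_seq_neq0 => /allP bt.
  have injt : injective (fun m => (t m).1).
    by apply/occ_inj_le1 => k; rewrite -e1; move: k; apply/occ_inj_le1.
  have tJ m : (t m).1 \in codom J.
    have : (0 < occ (fun m => (t m).1) (t m).1)%N by apply/occ_gt0P; exists m.
    by rewrite -e1 => /occ_gt0P[m' <-]; apply: codom_f.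
  have inj_s : injective (fun m => iinv (tJ m)).
    by move=> m1 m2 /(congr1 J); rewrite !f_iinv => /injt.
  pose s := perm inj_s; have sE m : J (s m) = (t m).1 by rewrite permE f_iinv.
  have le_t m : ((t m).2 <= lead (s m))%N.
    have [_ _] := leadP (s m); apply; last by rewrite sE (implyP (bt m (mem_index_enum m))).
    have : (0 < occ (fun m => (t m).2) (t m).2)%N by apply/occ_gt0P; exists m.
    by rewrite -e2 => /occ_gt0P[m' <-]; have [] := leadP m'.
  have eq_t : (fun m => (t m).2 : nat) =1 (fun m => lead (s m) : nat).
    apply: leq_sum_eq => //.
    rewrite (sum_perm (fun m => lead m : nat)).
    rewrite -(sum_occ (fun m => (t m).2) (fun k : 'I_n => k : nat)).
    rewrite -(sum_occ lead (fun k : 'I_n => k : nat)).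
    by apply: eq_bigr => k _; rewrite e2.
  apply/imsetP; exists s => //; apply/ffunP => m; rewrite ffunE sE.
  by rewrite -(val_inj (eq_t m)) -surjective_pairing.
rewrite (eq_bigl (fun t => t \in phi @: 'S_p.-1)) => [|t]; last first.
  rewrite andb_idl // => /imsetP[s _ ->]; apply/eqP; congr (_ %% _)%N.
  have -> : (\sum_m p ^ (phi s m).1 = \sum_m p ^ J m)%N.
    by rewrite -(sum_perm (fun m => p ^ J m)%N s); apply: eq_bigr => m _; rewrite ffunE.
  congr addn.
  by rewrite -(sum_perm (fun m => p ^ lead m)%N s); apply: eq_bigr => m _; rewrite ffunE.
rewrite big_imset /=; last by move=> s1 s2 _ _; apply: inj_phi.
under eq_bigr do rewrite prod_phi.
rewrite sumr_const card_Sn mulr0n; apply/eqP; rewrite -mulr_natr mulf_neq0 //.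
  by apply/prodf_neq0 => m _; have [] := leadP m.
rewrite -(dvdn_pcharf (card_finPcharP cardF p_pr)).
by rewrite prime_ndvd_fact // ltn_predL ltnW.
Qed.

(** * Choice of the p - 1 rows *)

(** A large shift jumps over p - 1 consecutive rows. A small one is detected modulo p among rows
    spaced by p, since i and i + 1 then lie between 1 and p - 1. The size of n keeps a shifted row
    from wrapping around onto a row. *)
Lemma progression_avoids_shift (p n i : nat) : (1 < p)%N ->
  ((p - 1) * (p ^ 2 - p + 4) <= 2 * n)%N -> (0 < i)%N -> (2 * i <= n)%N ->
  exists2 c, (0 < c)%N & forall m m', (m < p.-1)%N -> (m' < p.-1)%N ->
    [/\ (c * m < n)%N, (c * m + i) %% n != c * m'
      & (c * m + i + 1) %% n != c * m']%N.
Proof.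
move=> p1 n_ge i0 i_le.
have n3 : (3 * p.-1 <= n)%N.
  have := leq_trans (leq_mul (leqnn (p - 1)) (_ : 6 <= p ^ 2 - p + 4)%N) n_ge.
  have -> : (6 <= p ^ 2 - p + 4)%N by rewrite -mulnn; nia.
  by move=> /(_ isT); lia.
have [c [c0 c_lt avoid]] : exists c, [/\ (0 < c)%N,
   forall m, (m < p.-1)%N -> (c * m < n)%N
   & forall m m' e, (m < p.-1)%N -> (m' < p.-1)%N -> (e <= 1)%N ->
     (c * m + i + e != c * m' /\ c * m + i + e < c * m' + n)%N].
  (* c = 1 if i exceeds the length of the progression, and c = p otherwise. *)
  case: (leqP p.-1 i) => [i_ge|i_lt].
    exists 1%N; split=> // [m|m m' e] lt_m; first by lia.
    by move=> lt_m' e1; split; lia.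
  (* Here 0 < i < p - 1, so p - 1 >= 2 and the bound on n gives p^2 - p + 4 <= n. *)
  have n_big : (p * p.-1 + 4 <= n)%N.
    have : (2 * (p ^ 2 - p + 4) <= 2 * n)%N.
      by apply: leq_trans n_ge; rewrite leq_mul2r; lia.
    by rewrite -mulnn; nia.
  have le_pm m : (m < p.-1)%N -> (p * m + p <= p * p.-1)%N.
    by move=> lt_m; rewrite -mulnSr leq_mul2l lt_m orbT.
  exists p; split=> [|m /le_pm|m m' e /le_pm lt_m _ e1]; [lia|lia|split; last lia].
  apply/eqP => /(congr1 (fun x => x %% p)%N).
  by rewrite -addnA mulnC modnMDl modnMr modn_small; lia.
exists c => // m m' lt_m lt_m'; split; first exact: c_lt.
- have [] := avoid m m' 0%N lt_m lt_m' isT; rewrite addn0 => neq lt_n.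
  apply/negP => /eqP e; have := divn_eq (c * m + i) n; rewrite e.
  by case: (_ %/ n)%N => [|q]; rewrite ?mulSn; lia.
have [] := avoid m m' 1%N lt_m lt_m' isT => neq lt_n.
apply/negP => /eqP e; have := divn_eq (c * m + i + 1) n; rewrite e.
by case: (_ %/ n)%N => [|q]; rewrite ?mulSn; lia.
Qed.

Lemma ratio_form_shift (p n i : nat) (F : finFieldType)
    (b : 'I_n -> 'I_n -> F) :
  prime p -> ((p - 1) * (p ^ 2 - p + 4) <= 2 * n)%N -> #|F| = (p ^ n)%N ->
  (0 < i)%N -> (2 * i <= n)%N ->
  (forall j k : 'I_n, k = ((j + i) %% n)%N :> nat -> b j k != 0) ->
  ~ (forall x, x != 0 -> ratio_form p b x ^+ p.-1 = 1).
Proof.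
move=> p_pr n_ge cardF i0 i_le bi; have p1 := prime_gt1 p_pr.
have n2 : (2 < n)%N.
  have : (6 <= 2 * n)%N.
    apply: leq_trans n_ge; rewrite -[6%N]mul1n; apply: leq_mul; first lia.
    by rewrite -mulnn; nia.
  by lia.
have n0 : (0 < n)%N by lia.
have [c c0 cP] := progression_avoids_shift p1 n_ge i0 i_le.
pose J (m : 'I_p.-1) := Ordinal (ltn_pmod (c * m) n0).
pose K (m : 'I_p.-1) := Ordinal (ltn_pmod (c * m + i) n0).
have JE m : J m = (c * m)%N :> nat.
  by rewrite /= modn_small //; have [] := cP m m (ltn_ord m) (ltn_ord m).
apply: (@ratio_form_expr_neq1 p n F b J K) => //.
- move=> m1 m2 /(congr1 (@nat_of_ord n)); rewrite !JE.
  by move/eqP; rewrite eqn_pmul2l // => /eqP/val_inj.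
- by move=> m; apply: bi; rewrite JE.
move=> m m'; have [_ K1 K2] := cP m m' (ltn_ord m) (ltn_ord m').
split; rewrite -val_eqE; rewrite [X in _ != X]JE //=.
by rewrite -addn1 modnDml.
Qed.

(** * From the trace condition to the form f *)

(** Transposition exchanges the cyclic diagonals i and n - i, which reduces the theorem to 2i <=
    n. *)
Lemma ratio_form_inv (p n : nat) (F : fieldType) (b : 'I_n -> 'I_n -> F) (x : F) :
  ratio_form p (fun j k => b k j) x = ratio_form p b x^-1.
Proof.
rewrite /ratio_form exchange_big; apply: eq_bigr => j _; apply: eq_bigr => k _.
by congr (_ * _); rewrite !exprVn invrK mulrC.
Qed.

(** Frobenius powers distribute over the sum, and x^#|F| = x lets the column j + i be reduced modulo
    n + 1. *)
Lemma ratio_form_trace (p n : nat) (F : finFieldType) (a : 'I_n.+1 -> F) (x : F) :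
  prime p -> #|F| = (p ^ n.+1)%N -> x != 0 ->
  \sum_(j < n.+1) ((\sum_(i < n.+1) a i *: 'X^(p ^ i)).[x] / x) ^+ (p ^ j)
  = ratio_form p (fun j k => a (k - j) ^+ (p ^ j)) x.
Proof.
move=> p_pr cardF x0; have pF := card_finPcharP cardF p_pr.
have natp j : [pchar F].-nat (p ^ j)%N.
  by rewrite pnatX pnatE ?pF.
apply: eq_bigr => j _; rewrite [RHS](reindex_inj (addrI j)) /=.
rewrite horner_sum mulr_suml.
have -> : forall f : 'I_n.+1 -> F, (\sum_i f i) ^+ (p ^ j) = \sum_i f i ^+ (p ^ j).
  move=> f; elim/big_rec2: _ => [|i y1 y2 _ <-]; last by rewrite exprDn_pchar.
  by rewrite expr0n expn_eq0 -leqn0 leqNgt prime_gt0.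
apply: eq_bigr => i _; rewrite hornerZ hornerXn -addrA addrC.
rewrite addrNK !exprMn exprVn -mulrA; congr (_ * (_ / _)).
rewrite -exprM -expnD /=.
have xq k : x ^+ (p ^ (k + n.+1)) = x ^+ (p ^ k).
  by rewrite addnC expnD exprM -cardF expf_card.
case: (ltnP (j + i) n.+1) => [lt_ji|ge_ji]; first by rewrite modn_small // addnC.
have -> : ((j + i) %% n.+1 = j + i - n.+1)%N.
  by rewrite -{1}(subnK ge_ji) modnDr modn_small // ltn_subLR // -addnS leq_add // ltnW.
by rewrite -[RHS]xq subnK // addnC.
Qed.

(** Frobenius permutes the summands cyclically, so the trace y satisfies y^p = y. *)
Lemma trace_expr (p n : nat) (F : finFieldType) (z : F) :
  prime p -> #|F| = (p ^ n)%N -> \sum_(j < n) z ^+ (p ^ j) != 0 ->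
  (\sum_(j < n) z ^+ (p ^ j)) ^+ p.-1 = 1.
Proof.
move=> p_pr cardF y0; apply: (mulfI y0); rewrite -exprS prednK ?prime_gt0 // mulr1.
have pF := card_finPcharP cardF p_pr.
rewrite -(pFrobenius_autE pF) rmorph_sum /=.
case: n cardF {y0} => [|n] cardF; first by rewrite !big_ord0.
rewrite big_ord_recr big_ord_recl /= addrC pFrobenius_autE -exprM -expnSr -cardF.
rewrite expf_card expn0 expr1; congr (_ + _); apply: eq_bigr => j _.
by rewrite pFrobenius_autE -exprM -expnSr.
Qed.

Theorem theorem4p1 (p n : nat) (p_pr : prime p)
    (n_ge : ((p - 1) * (p ^ 2 - p + 4) <= 2 * n)%N)
    (F : finFieldType) (cardF : #|F| = (p ^ n)%N)
    (a : 'I_n -> F) (L : {poly F})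
    (defL : L = \sum_(i < n) a i *: 'X^(p ^ i)%N)
    (TrL : forall x : F, x != 0 -> absTrace p_pr cardF (L.[x] / x) != 0) :
  forall i : 'I_n, (0 < i)%N -> a i = 0.
Proof.
(* The successor form makes the index type a cyclic group, in which [k - j] is subtraction modulo
   the degree. *)
case: n => [|n] in n_ge cardF a defL TrL *; first by case.
move=> i i_gt0; apply/eqP/idPn => ai.
pose b (j k : 'I_n.+1) := a (k - j) ^+ (p ^ j).
have f1 x : x != 0 -> ratio_form p b x ^+ p.-1 = 1.
  move=> x0; have := TrL x x0; rewrite absTraceE.
  rewrite -ratio_form_trace // -defL; exact: trace_expr.
have bi (j k : 'I_n.+1) : k = j + i -> b j k != 0.
  by move=> ->; rewrite /b addrC addrA addNr add0r expf_neq0.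
case: (leqP (2 * i) n.+1) => [i_le|i_gt].
  apply: (ratio_form_shift p_pr n_ge cardF i_gt0 i_le _ f1) => j k e.
  by apply: bi; apply: val_inj.
apply: (@ratio_form_shift p n.+1 (n.+1 - i) F (fun j k => b k j) p_pr n_ge cardF);
  rewrite ?subn_gt0 //.
- by lia.
- move=> j k e; apply: bi; have -> : k = j - i; last by rewrite subrK.
  by apply: val_inj; rewrite /= e modnDmr.
- by move=> x x0; rewrite ratio_form_inv f1 // invr_eq0.
Qed.
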